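(* Let $X$ be a real Hilbert space and $A:X\to 2^X$ a maximally monotone operator with $A^{-1}(0)\ne\emptyset$. Consider the Algorithm described in the context, with arbitrary $x_0\in X$, arbitrary $\sigma\in[0,\infty)$ (including $\sigma\ge 1$), and an arbitrary sequence of positive numbers $(\mu_n)_{n=0}^\infty$. Then there exist sequences which satisfy the Algorithm in the exact and inexact cases. More precisely, for all $n\in\mathbb{N}\cup\{0\}$, if the Algorithm generates $x_n$ (namely, it does not terminate before iteration $n$), then at least one of the following possibilities holds: (i) $x_n$ is a zero of $A$ (i.e. $0\in Ax_n$). In this case the triplet $(y_n,\xi_n,\eta_n):=(x_n,0,0)$ satisfies the system (S) of the Algorithm. (ii) $\sigma=0$. In this case there exists a unique triplet $(y_n,\xi_n,\eta_n)\in X^3$ such that (S) holds, namely $y_n=(I+(1/\mu_n)A)^{-1}(x_n)$, $\xi_n=-\mu_n(y_n-x_n)$, $\eta_n=0$. (iii) $x_n$ is not a zero of $A$ and $\sigma>0$. In this case there exists $r_n>0$ such that for each $\eta_n\in X$ satisfying $\|\eta_n\|<r_n$ there exists a unique pair $(y_n,\xi_n)\in X^2$ such that (S) holds. In fact, $$y_n=\left(I+\frac{1}{\mu_n}A\right)^{-1}\left(x_n-\frac{1}{\mu_n}\eta_n\right),\qquad \xi_n=-\eta_n-\mu_n(y_n-x_n).$$ Furthermore, if $\sigma\in[0,1)$ and for some $n\in\mathbb{N}\cup\{0\}$ the Algorithm generates $x_n$ but terminates before generating $x_{n+1}$, then $x_n$ is a zero of $A$.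
   Context: $A:X\to 2^X$ is monotone if $\langle x_1^*-x_2^*,x_1-x_2\rangle\ge 0$ whenever $x_1^*\in Ax_1$, $x_2^*\in Ax_2$, and maximally monotone if its graph is not properly contained in the graph of another monotone operator. $A^{-1}(0)=\{z\in X:0\in Az\}$. $I$ is the identity; $(I+\lambda A)^{-1}(w)=\{x:w\in x+\lambda Ax\}$, which for maximally monotone $A$ and $\lambda>0$ is a singleton, identified with its element. Algorithm. Initialization: choose $x_0\in X$, $\sigma\ge 0$, and positive numbers $(\mu_n)_{n=0}^\infty$. Iterative step: given $n\in\mathbb{N}\cup\{0\}$ and $x_n\in X$, find $(y_n,\xi_n,\eta_n)\in X^3$ satisfying the system $$\text{(S)}\qquad \xi_n\in A(y_n),\quad 0=\xi_n+\mu_n(y_n-x_n)+\eta_n,\quad \|\eta_n\|\le\sigma\max\{\|\xi_n\|,\mu_n\|y_n-x_n\|\}.$$ If $\xi_n=0$ or $y_n=x_n$, then stop. Otherwise let $$x_{n+1}:=x_n-\frac{\langle\xi_n,x_n-y_n\rangle}{\|\xi_n\|^2}\xi_n.$$ ''Exact'' refers to $\eta_n=0$ and ''inexact'' to $\eta_n\ne 0$. *)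

(* Defs.v *)
From HB Require Import structures.
From mathcomp Require Import all_boot all_order all_algebra.
From mathcomp Require Import all_classical all_reals all_analysis.

Set Implicit Arguments.
Unset Strict Implicit.
Unset Printing Implicit Defensive.

Import Order.TTheory GRing.Theory Num.Theory.
Import numFieldNormedType.Exports.

Local Open Scope classical_set_scope.
Local Open Scope ring_scope.

(* A real Hilbert space is a complete normed module [X] over a [realType]
   together with an inner product [dot : {dot X for idfun}] (bilinear,
   symmetric, positive definite) which induces the norm of [X]. *)
Definition induces_norm (R : realType) (X : completeNormedModType R)
    (dot : {dot X for idfun}) : Prop :=
  forall u : X, `|u| = Num.sqrt (dot u u).

Section Operators.
Variables (R : realType) (X : completeNormedModType R).
Variable (dot : {dot X for idfun}).
Implicit Types A B : X -> set X.

Definition graph A : set (X * X) := [set p | A p.1 p.2].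

Definition monotone A : Prop :=
  forall x1 x2 u1 u2 : X, A x1 u1 -> A x2 u2 -> 0 <= dot (u1 - u2) (x1 - x2).

Definition maximally_monotone A : Prop :=
  monotone A /\ forall B, monotone B -> ~ (graph A `<` graph B).

Definition zeros A : set X := [set z | A z 0].

(* [(I + lambda A)^-1 w], as a set. *)
Definition resolvent A (lambda : R) (w : X) : set X :=
  [set x | exists2 u, A x u & w = x + lambda *: u].

End Operators.

Section Algorithm.
Variables (R : realType) (X : completeNormedModType R).
Variable (dot : {dot X for idfun}).
Variables (A : X -> set X) (sigma : R) (mu : nat -> R) (x0 : X).

(* System (S) for the parameter [m] (namely [mu n]) and the iterate [x]. *)
Definition system (m : R) (x : X) : X * X * X -> Prop :=
  fun '(y, xi, eta) =>
    [/\ A y xi,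
        0 = xi + m *: (y - x) + eta
      & `|eta| <= sigma * Num.max `|xi| (m * `|y - x|)].

Definition stops (x y xi : X) : Prop := xi = 0 \/ y = x.

Definition next (x y xi : X) : X :=
  x - (dot xi (x - y) / `|xi| ^+ 2) *: xi.

(* The iterations [0, ..., n - 1] were performed without termination, so that
   [x n] has been generated.  Only [x k] for [k <= n] and [y k], [xi k],
   [eta k] for [k < n] matter. *)
Definition generates (x y xi eta : nat -> X) (n : nat) : Prop :=
  x 0%N = x0 /\
  forall k, (k < n)%N ->
    [/\ system (mu k) (x k) (y k, xi k, eta k),
        ~ stops (x k) (y k) (xi k)
      & x k.+1 = next (x k) (y k) (xi k)].

(* A complete execution, either infinite or ending at the first [n] for which
   the stopping rule applies; values past termination are unconstrained. *)
Definition execution (x y xi eta : nat -> X) : Prop :=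
  x 0%N = x0 /\
  forall n, generates x y xi eta n ->
    system (mu n) (x n) (y n, xi n, eta n) /\
    (~ stops (x n) (y n) (xi n) -> x n.+1 = next (x n) (y n) (xi n)).

End Algorithm.

(* Main.v *)
Require Import Defs.
From HB Require Import structures.
From mathcomp Require Import all_boot all_order all_algebra.
From mathcomp Require Import all_classical all_reals all_analysis.
From mathcomp Require Import ring lra.

Set Implicit Arguments.
Unset Strict Implicit.
Unset Printing Implicit Defensive.

Import Order.TTheory GRing.Theory Num.Theory.
Import numFieldNormedType.Exports.

Local Open Scope classical_set_scope.
Local Open Scope ring_scope.

(** The substance is Minty's theorem: [I + lambda A] is onto.  Minimise over
[(a, b)] the least [s] such that [|v - a|^2 + |y - b|^2 <= s + |v + y|^2] on
the graph of [A] (up to signs, twice the Fitzpatrick function plus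
[|a|^2 + |b|^2]).  By the parallelogram law minimising sequences are Cauchy, and
a minimiser [(a, b)] with value [m] satisfies [|a - a'|^2 + |b - b'|^2 <= s' - m]
for every competitor.  Points [(y, v)] of the graph yield competitors
[(- y, - v)] with value [|y + v|^2], while maximality gives [|a + b|^2 <= m];
hence [<a - v, b - y> >= |a + b|^2] on the graph, so [a] is in [A b], and taking
[(y, v) = (b, a)] gives [a = - b].

For fixed [eta], system (S) then says that [y] is the value of the resolvent at
[x - eta / mu], plus the error bound, which holds for all small [eta] when [x]
is not a fixed point of the resolvent, that is, not a zero of [A]. *)

(** * Inner product identities, convergence of minimising sequences, maximality *)

Section RealHilbert.
Variables (R : realType) (X : completeNormedModType R).
Variables (dot : {dot X for idfun}) (dot_norm : induces_norm dot).
Implicit Types (u v w : X) (t : R).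

Lemma dotC u v : dot u v = dot v u.
Proof. by rewrite hermC /= expr0 mul1r. Qed.

Lemma dotDl u v w : dot (u + v) w = dot u w + dot v w.
Proof. exact: linearDl. Qed.

Lemma dotNl u w : dot (- u) w = - dot u w.
Proof. exact: linearNl. Qed.

Lemma dotZl t u w : dot (t *: u) w = t * dot u w.
Proof. exact: linearZl_LR. Qed.

Lemma dotDr u v w : dot w (u + v) = dot w u + dot w v.
Proof. by rewrite dotC dotDl !(dotC _ w). Qed.

Lemma dotNr u w : dot w (- u) = - dot w u.
Proof. by rewrite dotC dotNl dotC. Qed.

Lemma dotZr t u w : dot w (t *: u) = t * dot w u.
Proof. by rewrite dotC dotZl dotC. Qed.

Definition dotE := (dotDl, dotNl, dotZl, dotDr, dotNr, dotZr).

Lemma dot_ge0 u : 0 <= dot u u.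
Proof.
have [->|u_neq0] := eqVneq u 0; first by rewrite [dot _ _]linear0l.
exact/ltW/neq0_dnorm_gt0.
Qed.

Lemma sqr_norm u : `|u| ^+ 2 = dot u u.
Proof. by rewrite dot_norm sqr_sqrtr // dot_ge0. Qed.

(** Stewart's identity; [t = 1/2] is the parallelogram law. *)
Lemma sqr_dist_conv u v w t :
  `|w - ((1 - t) *: u + t *: v)| ^+ 2 =
  (1 - t) * `|w - u| ^+ 2 + t * `|w - v| ^+ 2 - t * (1 - t) * `|u - v| ^+ 2.
Proof.
rewrite !sqr_norm !dotE (dotC u w) (dotC v w) (dotC v u); ring.
Qed.

Lemma cvg_of_sqr_dist (u : nat -> X) :
  (forall n k, `|u n - u k| ^+ 2 <= 2 * (n.+1%:R^-1 + k.+1%:R^-1)) ->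
  cvg (u @ \oo).
Proof.
move=> udist; apply: cauchy_cvg; apply: cauchy_exP => e e_gt0.
(* Two errors below [e ^+ 2 / 4] make [2 * (p + q)] smaller than [e ^+ 2]. *)
have d_gt0 : 0 < e ^+ 2 / 4 by rewrite divr_gt0 ?exprn_gt0.
have [N _ Nlt] := near_infty_natSinv_lt (PosNum d_gt0).
exists (u N); exists N => // k /= Nk.
rewrite -ball_normE /ball_ /= -(ltr_pXn2r (ltn0Sn 1)) ?nnegrE ?normr_ge0 ?ltW //.
apply: le_lt_trans (udist N k) _.
have /= := Nlt N (leqnn N); have /= := Nlt k Nk.
by move: N.+1%:R^-1 k.+1%:R^-1 (e ^+ 2) => p q r; lra.
Qed.

(** Otherwise adjoining [(y, v)] would give a monotone operator with a strictly larger graph. *)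
Lemma maximal_in_graph A : maximally_monotone dot A -> forall y v,
  (forall y' v', A y' v' -> 0 <= dot (v - v') (y - y')) -> A y v.
Proof.
move=> [monA maxA] y v rel; apply: contrapT => nAyv.
pose B := fun x => A x `|` [set u | x = y /\ u = v].
apply: (maxA B) => [x1 x2 u1 u2 [A1|[-> ->]] [A2|[-> ->]]|].
- exact: monA.
- rewrite -(opprB v u1) -(opprB y x1) dotNl dotNr opprK; exact: rel.
- exact: rel.
- by rewrite subrr [dot _ _]linear0l.
split=> [[x u] /= Axu|BA]; first by left.
by apply: nAyv; apply: (BA (y, v)); right.
Qed.

(** * Minty's theorem by minimisation *)

Section Minty.
Variable A : X -> set X.

Definition fits (s : R) (a b : X) : Prop := forall y v, A y v ->
  `|v - a| ^+ 2 + `|y - b| ^+ 2 <= s + `|v + y| ^+ 2.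

(** The quadratic gain along a segment is the same for every point [(y, v)] of the graph, so it can
    be subtracted from the constant. *)
Lemma fits_conv s a b s' a' b' t : 0 <= t <= 1 ->
  fits s a b -> fits s' a' b' ->
  fits ((1 - t) * s + t * s' - t * (1 - t) * (`|a - a'| ^+ 2 + `|b - b'| ^+ 2))
    ((1 - t) *: a + t *: a') ((1 - t) *: b + t *: b').
Proof.
move=> /andP[t_ge0 t_le1] f f' y v Ayv; rewrite !sqr_dist_conv.
have := f _ _ Ayv; have := f' _ _ Ayv.
have t1_ge0 : 0 <= 1 - t by rewrite subr_ge0.
move=> /(ler_wpM2l t_ge0) h' /(ler_wpM2l t1_ge0) h; lra.
Qed.

Lemma fits_min s0 a0 b0 : fits s0 a0 b0 ->
  (forall s a b, fits s a b -> 0 <= s) ->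
  exists m a b, fits m a b /\ forall s' a' b', fits s' a' b' ->
    `|a - a'| ^+ 2 + `|b - b'| ^+ 2 <= s' - m.
Proof.
move=> f0 s_ge0.
pose S := [set s | exists a b, fits s a b].
have Slb : has_lbound S by exists 0 => s [a [b /s_ge0]].
have infS : has_inf S by split => //; exists s0, a0, b0.
pose m := inf S.
have m_le s a b : fits s a b -> m <= s by move=> f; apply: ge_inf => //; exists a, b.
have ex n : {p : X * X | fits (m + n.+1%:R^-1) p.1 p.2}.
  apply: cid; have n_gt0 : 0 < n.+1%:R^-1 :> R by rewrite invr_gt0 ltr0Sn.
  have [s [a [b f]] s_lt] := inf_adherent n_gt0 infS.
  exists (a, b) => y v /f /= fyv; apply: le_trans fyv _.
  by rewrite lerD2r ltW.
pose a n := (sval (ex n)).1; pose b n := (sval (ex n)).2.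
have fab n : fits (m + n.+1%:R^-1) (a n) (b n) := svalP (ex n).
have close n k : `|a n - a k| ^+ 2 + `|b n - b k| ^+ 2
    <= 2 * (n.+1%:R^-1 + k.+1%:R^-1).
  (* The midpoint has value at least [m], which bounds the gain, a quarter of the squared
     distance. *)
  have h : 0 <= (2^-1 : R) <= 1 by lra.
  have := m_le _ _ _ (fits_conv h (fab n) (fab k)).
  by move: n.+1%:R^-1 k.+1%:R^-1 => p q; lra.
have cva : cvg (a @ \oo).
  by apply: cvg_of_sqr_dist => n k; apply: le_trans (close n k); rewrite lerDl sqr_ge0.
have cvb : cvg (b @ \oo).
  by apply: cvg_of_sqr_dist => n k; apply: le_trans (close n k); rewrite lerDr sqr_ge0.
set al := lim (a @ \oo) in cva; set bl := lim (b @ \oo) in cvb.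
(* For each fixed [(y, v)] the inequality passes to the limit. *)
have fl : fits m al bl.
  move=> y v Ayv.
  have cvL : `|v - a n| ^+ 2 + `|y - b n| ^+ 2 @[n --> \oo] -->
      `|v - al| ^+ 2 + `|y - bl| ^+ 2.
    by apply: cvgD; rewrite expr2; apply: cvgM; apply: cvg_norm; apply: cvgB => //; exact: cvg_cst.
  apply/ler_addgt0Pr => e e_gt0.
  rewrite -(cvg_lim (@Rhausdorff R) cvL); apply: limr_le.
    by apply/cvg_ex; eexists; exact: cvL.
  have [N _ Nlt] := near_infty_natSinv_lt (PosNum e_gt0).
  exists N => // n /Nlt /=; have := fab n _ _ Ayv.
  by move: n.+1%:R^-1 => p; lra.
exists m, al, bl; split=> // s' a' b' f'.
set d := (X in X <= _).
have d_ge0 : 0 <= d by rewrite addr_ge0 ?sqr_ge0.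
(* Compare [m] with the value at parameter [t] on the segment and divide by [t]; then [t] tends to
   0, by a choice with [t * d <= e]. *)
have key t : 0 < t -> t < 1 -> (1 - t) * d <= s' - m.
  move=> t0 t1; have ht : 0 <= t <= 1 by rewrite !ltW.
  have := m_le _ _ _ (fits_conv ht fl f'); rewrite -/d => h.
  by rewrite -(ler_pM2l t0); lra.
apply/ler_addgt0Pr => e e_gt0.
pose t := e / (1 + d + e).
have D_gt0 : 0 < 1 + d + e by lra.
have t0 : 0 < t by rewrite divr_gt0.
have t1 : t < 1 by rewrite ltr_pdivrMr //; lra.
have td : t * d <= e.
  by rewrite /t mulrAC ler_pdivrMr // ler_pM2l //; lra.
have := key t t0 t1; lra.
Qed.

(** [relA] is maximality in a form that transfers easily to a rescaled and shifted operator. *)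
Hypotheses (monA : Defs.monotone dot A) (relA : forall y v,
  (forall y' v', A y' v' -> 0 <= dot (v - v') (y - y')) -> A y v).

(** The two sides differ by twice the monotonicity product of the two graph points. *)
Lemma fits_graph y v : A y v -> fits (`|y + v| ^+ 2) (- y) (- v).
Proof.
move=> Ayv y' v' Ayv'; have := monA Ayv Ayv'.
rewrite !sqr_norm !dotE.
rewrite (dotC y v') (dotC y' v) (dotC y v) (dotC y' v'); lra.
Qed.

(* If [(- a, - b)] is not in the graph, maximality provides a point of the graph
   that is not monotonically related to it. *)
Lemma fits_ge s a b : fits s a b -> `|a + b| ^+ 2 <= s.
Proof.
move=> f; case: (pselect (A (- a) (- b))) => [/f|nA].
  rewrite !sqr_norm !dotE (dotC b a); have := dot_ge0 (a + b).
  rewrite !dotE (dotC b a); lra.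
have /existsNP[y /existsNP[v /not_implyP[Ayv /negP]]] :
    ~ forall y v, A y v -> 0 <= dot (- b - v) (- a - y).
  by move/relA.
rewrite -ltNge; have := f _ _ Ayv; rewrite !sqr_norm !dotE.
rewrite (dotC b a) (dotC a v) (dotC b y) (dotC y v) (dotC y b); lra.
Qed.

Lemma minty : (exists y v, A y v) -> exists x, A x (- x).
Proof.
move=> [y0 [v0 Ayv0]].
have s_ge0 s a b : fits s a b -> 0 <= s.
  by move/fits_ge; apply: le_trans; rewrite sqr_ge0.
have [m [a [b [f fmin]]]] := fits_min (fits_graph Ayv0) s_ge0.
have m_ge := fits_ge f.
have rel y v : A y v -> `|a + b| ^+ 2 <= dot (a - v) (b - y).
  move=> /fits_graph /fmin; move: m_ge; rewrite !sqr_norm !dotE.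
  rewrite (dotC b a) (dotC y v) (dotC y a) (dotC v b) (dotC b v); lra.
have Aba : A b a.
  by apply: relA => y v /rel; apply: le_trans; rewrite sqr_ge0.
exists b; suff : a + b = 0 by move/eqP; rewrite addr_eq0 => /eqP <-.
have := rel _ _ Aba; rewrite subrr [dot _ _]linear0l => h.
by apply/eqP; rewrite -normr_eq0 -sqrf_eq0 eq_le h sqr_ge0.
Qed.

End Minty.

(** * Existence, uniqueness and nonexpansiveness of the resolvent *)

Section Resolvent.
Variables (A : X -> set X) (maxA : maximally_monotone dot A).
Hypothesis zA : zeros A !=set0.

Lemma resolvent_neq0 t w : 0 < t -> resolvent A t w !=set0.
Proof.
move=> t_gt0; have t_neq0 := lt0r_neq0 t_gt0.
(* [B] is [t A - w], so [- x] in [B x] means that [w] lies in [x + t A x]. *)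
pose B : X -> set X := fun x u => A x (t^-1 *: (u + w)).
have monB : Defs.monotone dot B.
  move=> x1 x2 u1 u2 /= A1 A2; have := maxA.1 _ _ _ _ A1 A2.
  by rewrite -scalerBr opprD addrACA subrr addr0 dotZl pmulr_rge0 ?invr_gt0.
have relB y v : (forall y' v', B y' v' -> 0 <= dot (v - v') (y - y')) -> B y v.
  move=> rel; apply: (maximal_in_graph maxA) => y' v' Ayv'.
  have /rel : B y' (t *: v' - w) by rewrite /B subrK scalerA mulVf // scale1r.
  rewrite opprB addrA -(@pmulr_rge0 _ t^-1) ?invr_gt0 //.
  by rewrite -dotZl scalerBr scalerA mulVf // scale1r.
have [x Bx] : exists x, B x (- x).
  have [z Az] := zA.
  by apply: minty => //; exists z, (- w); rewrite /B addNr scaler0.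
exists x, (t^-1 *: (- x + w)) => //.
by rewrite scalerA divff // scale1r addNKr.
Qed.

(** In the expansion of the squared norm of [x + t *: u], monotonicity makes the cross term
    nonnegative. *)
Lemma resolvent_nonexpansive t w1 w2 x1 x2 : 0 < t ->
  resolvent A t w1 x1 -> resolvent A t w2 x2 -> `|x1 - x2| <= `|w1 - w2|.
Proof.
move=> t_gt0 [u1 A1 ->] [u2 A2 ->].
rewrite -ler_sqr ?nnegrE // opprD addrACA -scalerBr !sqr_norm.
have := maxA.1 _ _ _ _ A1 A2; move: (x1 - x2) (u1 - u2) => x u h.
have := dot_ge0 (t *: u); have := mulr_ge0 (ltW t_gt0) h.
by rewrite !dotE (dotC x u); lra.
Qed.

Lemma resolvent_set1 t w : 0 < t -> exists x, resolvent A t w = [set x].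
Proof.
move=> t_gt0; have [x Jx] := resolvent_neq0 w t_gt0.
exists x; apply/seteqP; split=> [x' Jx'|_ ->] //=; apply/eqP.
have := resolvent_nonexpansive t_gt0 Jx' Jx.
by rewrite subrr normr0 normr_le0 subr_eq0.
Qed.

Lemma resolventP m x eta y : 0 < m ->
  resolvent A m^-1 (x - m^-1 *: eta) y <-> A y (- eta - m *: (y - x)).
Proof.
move=> m_gt0; have m_neq0 := lt0r_neq0 m_gt0.
split=> [[u Ayu e]|Ay].
  move/(congr1 ( *:%R m)): e.
  rewrite scalerBr scalerDr !scalerA divff // !scale1r => e.
  by rewrite scalerBr opprB addrA (addrC (- eta)) e addrAC subrr add0r.
exists (- eta - m *: (y - x)) => //.
rewrite scalerBr scalerA mulVf // scale1r scalerN opprB.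
by rewrite addrCA subrKC addrC.
Qed.

Lemma resolvent_fix_zero t w : 0 < t -> resolvent A t w w -> zeros A w.
Proof.
move=> t_gt0 [u Awu /eqP]; rewrite -[X in X == _]addr0 (inj_eq (addrI w)).
by rewrite eq_sym scaler_eq0 gt_eqF //= => /eqP u0; rewrite u0 in Awu.
Qed.

End Resolvent.

(** * Solvability of (S), termination, and construction of executions *)

Section Iteration.
Variables (A : X -> set X) (maxA : maximally_monotone dot A).
Hypothesis zA : zeros A !=set0.
Variables (sigma : R) (sigma_ge0 : 0 <= sigma).

Lemma systemP m x y xi eta : 0 < m ->
  system A sigma m x (y, xi, eta) <->
  [/\ resolvent A m^-1 (x - m^-1 *: eta) y, xi = - eta - m *: (y - x)
    & `|eta| <= sigma * Num.max `|xi| (m * `|y - x|)].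
Proof.
move=> m_gt0; split=> [[Ay /eqP e bd]|[/resolventP Ay -> bd]].
  have xiE : xi = - eta - m *: (y - x).
    by move: e; rewrite eq_sym -addrA addr_eq0 opprD addrC => /eqP.
  by split=> //; apply/resolventP => //; rewrite -xiE.
by split=> //; [exact: Ay | rewrite subrK addNr].
Qed.

(** The singleton resolvent determines [y], and the equation in (S) then determines [xi]; only the
    error bound is left as a premise. *)
Lemma unique_system m x eta : 0 < m ->
  (forall y, resolvent A m^-1 (x - m^-1 *: eta) y ->
     `|eta| <= sigma * Num.max `|- eta - m *: (y - x)| (m * `|y - x|)) ->
  exists y, resolvent A m^-1 (x - m^-1 *: eta) = [set y] /\
    unique (fun p : X * X => system A sigma m x (p.1, p.2, eta))
      (y, - eta - m *: (y - x)).
Proof.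
move=> m_gt0 bd; have minv_gt0 : 0 < m^-1 by rewrite invr_gt0.
have [y Jy] := resolvent_set1 maxA zA (x - m^-1 *: eta) minv_gt0.
exists y; split=> //; split=> [|[y' xi'] /(systemP _ _ _ _ m_gt0) [+ /= -> _]].
  by apply/systemP => //=; split=> //; [rewrite Jy | apply: bd; rewrite Jy].
by rewrite Jy /= => ->.
Qed.

Lemma system_zero m x : zeros A x -> system A sigma m x (x, 0, 0).
Proof.
move=> Ax; split=> //; first by rewrite subrr scaler0 !addr0.
by rewrite normr0 mulr_ge0 // le_max lexx.
Qed.

Lemma unique_exact_system m x : 0 < m ->
  exists y, resolvent A m^-1 x = [set y] /\
    unique (fun p : X * X => system A sigma m x (p.1, p.2, 0))
      (y, - (m *: (y - x))).
Proof.
move=> m_gt0; have [|y] := @unique_system m x 0 m_gt0.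
  by move=> y _; rewrite normr0 mulr_ge0 // le_max normr_ge0.
by rewrite scaler0 subr0 oppr0 add0r => ?; exists y.
Qed.

(* By nonexpansiveness the step [|y - x|] stays at least
   [|J x - x| - |eta| / m], which is positive for small [eta]. *)
Lemma unique_inexact_system m x : 0 < m -> 0 < sigma -> ~ zeros A x ->
  exists2 r : R, 0 < r & forall eta, `|eta| < r ->
    exists y, resolvent A m^-1 (x - m^-1 *: eta) = [set y] /\
      unique (fun p : X * X => system A sigma m x (p.1, p.2, eta))
        (y, - eta - m *: (y - x)).
Proof.
move=> m_gt0 sigma_gt0 nAx; have minv_gt0 : 0 < m^-1 by rewrite invr_gt0.
have [y0 Jy0] := resolvent_neq0 maxA zA x minv_gt0.
have d_gt0 : 0 < `|y0 - x|.
  rewrite normr_gt0 subr_eq0; apply/eqP => y0x; rewrite y0x in Jy0.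
  exact/nAx/(resolvent_fix_zero minv_gt0 Jy0).
have s1_gt0 : 0 < 1 + sigma by rewrite ltr_wpDl.
(* With [d = m * |y0 - x|], this is the value of [|eta|] at which [|eta| = sigma * (d - |eta|)]. *)
exists (sigma * (m * `|y0 - x|) / (1 + sigma)) => [|eta eta_lt].
  by rewrite divr_gt0 ?mulr_gt0.
apply: unique_system => // y Jy.
have near : m * `|y0 - y| <= `|eta|.
  have := resolvent_nonexpansive maxA minv_gt0 Jy0 Jy.
  rewrite subKr normrZ gtr0_norm // => h.
  by rewrite -(ler_pM2l minv_gt0) mulKf ?lt0r_neq0.
have tri := ler_distD y y0 x.
have step : m * `|y0 - x| - `|eta| <= m * `|y - x|.
  rewrite lerBlDr; apply: le_trans (_ : m * (`|y0 - y| + `|y - x|) <= _).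
    by rewrite ler_pM2l.
  by rewrite mulrDr addrC lerD2l.
apply: le_trans (_ : sigma * (m * `|y - x|) <= _); last first.
  by rewrite ler_pM2l // le_max lexx orbT.
move: eta_lt; rewrite ltr_pdivlMr // => eta_lt.
have := ler_wpM2l sigma_ge0 step; lra.
Qed.

(** Under either stopping condition the maximum in (S) equals [|eta|], so [sigma < 1] forces
    [eta = 0], and then both [xi = 0] and [y = x]. *)
Lemma stops_zero m x y xi eta : sigma < 1 -> 0 < m ->
  system A sigma m x (y, xi, eta) -> stops x y xi -> zeros A x.
Proof.
move=> sigma_lt1 m_gt0 [Ay e bd] st.
have contr u : `|u| <= sigma * `|u| -> u = 0.
  move=> h; apply/eqP; rewrite -normr_le0; have := normr_ge0 u; nra.
case: st => [xi0|yx].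
  move: e bd Ay; rewrite xi0 add0r normr0 max_r ?mulr_ge0 ?(ltW m_gt0) // => e.
  rewrite -[in X in _ * X](gtr0_norm m_gt0) -normrZ.
  have -> : eta = - (m *: (y - x)).
    by apply/eqP; rewrite -addr_eq0 addrC -e.
  rewrite normrN => /contr /eqP; rewrite scaler_eq0 gt_eqF //= subr_eq0.
  by move=> /eqP ->.
move: e bd Ay; rewrite yx subrr scaler0 addr0 normr0 mulr0 max_l // => e.
have -> : eta = - xi by apply/eqP; rewrite -addr_eq0 addrC -e.
by rewrite normrN => /contr ->.
Qed.

Lemma exists_execution (mu : nat -> R) x0 (P : X -> X -> Prop) :
  (forall n x, exists y xi eta, system A sigma (mu n) x (y, xi, eta) /\ P x eta) ->
  exists x y xi eta : nat -> X,
    execution dot A sigma mu x0 x y xi eta /\ forall n, P (x n) (eta n).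
Proof.
move=> ex.
have ex' n x : {p : X * X * X | system A sigma (mu n) x p /\ P x p.2}.
  by apply: cid; have [y [xi [eta h]]] := ex n x; exists (y, xi, eta).
pose p n x := sval (ex' n x).
have pP n x : system A sigma (mu n) x (p n x) /\ P x (p n x).2 := svalP (ex' n x).
(* The recursion runs on past the stopping rule; an execution leaves those values free. *)
pose x := nat_rect (fun=> X) x0 (fun n z => Defs.next dot z (p n z).1.1 (p n z).1.2).
exists x, (fun n => (p n (x n)).1.1), (fun n => (p n (x n)).1.2).
exists (fun n => (p n (x n)).2); split=> [|n]; last exact: (pP n (x n)).2.
split=> // n _; split=> //.
by have := (pP n (x n)).1; case: (p n (x n)) => [[]].
Qed.

End Iteration.
End RealHilbert.

Theorem theorem9p2 (R : realType) (X : completeNormedModType R)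
    (dot : {dot X for idfun}) (dot_norm : induces_norm dot)
    (A : X -> set X) (maxA : maximally_monotone dot A)
    (zA : zeros A !=set0)
    (x0 : X) (sigma : R) (sigma_ge0 : 0 <= sigma)
    (mu : nat -> R) (mu_gt0 : forall n, 0 < mu n) :
  (* existence of exact and of inexact executions *)
  (exists x y xi eta : nat -> X,
     execution dot A sigma mu x0 x y xi eta /\
     forall n, generates dot A sigma mu x0 x y xi eta n -> eta n = 0) /\
  (0 < sigma ->
   exists x y xi eta : nat -> X,
     execution dot A sigma mu x0 x y xi eta /\
     forall n, generates dot A sigma mu x0 x y xi eta n ->
       ~ zeros A (x n) -> eta n <> 0) /\
  (forall (x y xi eta : nat -> X) (n : nat),
     generates dot A sigma mu x0 x y xi eta n ->
     (* one of the three possibilities holds *)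
     [\/ zeros A (x n), sigma = 0 | ~ zeros A (x n) /\ 0 < sigma] /\
     (* (i) *)
     (zeros A (x n) -> system A sigma (mu n) (x n) (x n, 0, 0)) /\
     (* (ii) *)
     (sigma = 0 ->
      exists yn : X,
        resolvent A (mu n)^-1 (x n) = [set yn] /\
        unique (system A sigma (mu n) (x n)) (yn, - (mu n *: (yn - x n)), 0)) /\
     (* (iii) *)
     (~ zeros A (x n) /\ 0 < sigma ->
      exists2 r : R, 0 < r &
        forall etan : X, `|etan| < r ->
          exists yn : X,
            resolvent A (mu n)^-1 (x n - (mu n)^-1 *: etan) = [set yn] /\
            unique (fun p : X * X =>
                      system A sigma (mu n) (x n) (p.1, p.2, etan))
                   (yn, - etan - mu n *: (yn - x n)))) /\
  (* termination at iteration [n] *)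
  (sigma < 1 ->
   forall (x y xi eta : nat -> X) (n : nat),
     generates dot A sigma mu x0 x y xi eta n ->
     system A sigma (mu n) (x n) (y n, xi n, eta n) ->
     stops (x n) (y n) (xi n) ->
     zeros A (x n)).
Proof.
have exact_unique n x := unique_exact_system dot_norm maxA zA sigma_ge0 x (mu_gt0 n).
have inexact_unique n x := unique_inexact_system dot_norm maxA zA sigma_ge0 (mu_gt0 n) (x := x).
split; [|split; [|split]].
- have [n x|x [y [xi [eta [ex eta0]]]]] :=
    @exists_execution _ _ dot A sigma mu x0 (fun _ eta => eta = 0).
    have [y [_ [sy _]]] := exact_unique n x.
    by exists y, (- (mu n *: (y - x))), 0.
  by exists x, y, xi, eta.
- move=> sigma_gt0.
  have [n x|x [y [xi [eta [ex eta0]]]]] :=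
    @exists_execution _ _ dot A sigma mu x0 (fun x eta => ~ zeros A x -> eta <> 0).
    have [Ax|nAx] := pselect (zeros A x).
      by exists x, 0, 0; split=> //; exact: system_zero.
    have [r r_gt0 h] := inexact_unique n x sigma_gt0 nAx.
    (* A nonzero [eta] of norm below [r] needs a nonzero direction: [z - x] is one, since [z] is a
       zero and [x] is not. *)
    have [z Az] := zA.
    have zx : 0 < `|z - x|.
      by rewrite normr_gt0 subr_eq0; apply/eqP => zx; rewrite -zx in nAx.
    pose eta := (r / 2 / `|z - x|) *: (z - x).
    have eta_norm : `|eta| = r / 2.
      by rewrite normrZ normrM normfV normr_id divfK ?lt0r_neq0 // gtr0_norm ?divr_gt0.
    have [|y [_ [sy _]]] := h eta; first by rewrite eta_norm; lra.
    exists y, (- eta - mu n *: (y - x)), eta; split=> // _ eta0.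
    by move: eta_norm; rewrite eta0 normr0; lra.
  by exists x, y, xi, eta; split=> // n _; exact: eta0.
- move=> x y xi eta n _; split; [|split; [|split]].
  + have [Ax|nAx] := pselect (zeros A (x n)); first exact: Or31.
    have [->|sigma_neq0] := eqVneq sigma 0; first exact: Or32.
    by apply: Or33; rewrite lt_def sigma_neq0.
  + exact: system_zero.
  + move=> sigma0; have [yn [Jyn [syn uyn]]] := exact_unique n (x n).
    exists yn; split=> //; split=> // -[[y' xi'] eta'] s'.
    have eta'0 : eta' = 0.
      by case: s' => _ _; rewrite sigma0 mul0r normr_le0 => /eqP.
    by rewrite eta'0 in s' *; have [-> ->] := uyn (y', xi') s'.
  + by move=> [nAx sigma_gt0]; exact: inexact_unique.
- move=> sigma_lt1 x y xi eta n _; exact: stops_zero.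
Qed.
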